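(* Let $n\ge 4$, let $c=(c_1,\dots,c_m)$ be a cardinality sequence with $m\ge 2$, $2\le c_1<\dots<c_m\le n$ and $c\ne(2,3)$, and let $i\in\{1,\dots,n-1\}$ be an internal node of $\tilde D_n$. If $c\neq(2,n)$, then the degree constraint $x(\delta^{\mathrm{out}}(i))\le 1$ induces a facet of $P^{c}_{0,n\text{-path}}(\tilde D_n)$.
   Context: $\tilde D_n=(\tilde N_n,\tilde A_n)$ is the digraph with $\tilde N_n=\{0,1,\dots,n\}$ and $\tilde A_n=\{(0,i),(i,n): i=1,\dots,n-1\}\cup\{(i,j):1\le i,j\le n-1, i\ne j\}$. $P^{c}_{0,n\text{-path}}(\tilde D_n)\subseteq\mathbb{R}^{\tilde A_n}$ is the convex hull of the incidence vectors of simple directed $(0,n)$-paths in $\tilde D_n$ whose number of arcs is in $\{c_1,\dots,c_m\}$. $\delta^{\mathrm{out}}(i)$ is the set of arcs leaving $i$ and $x(F)=\sum_{a\in F}x_a$. *)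

(* Defs.v *)
From HB Require Import structures.
From mathcomp Require Import all_boot all_order all_algebra.
From mathcomp Require Import classical_sets reals.

Set Implicit Arguments.
Unset Strict Implicit.
Unset Printing Implicit Defensive.

Import Order.TTheory GRing.Theory Num.Theory.

Local Open Scope classical_set_scope.
Local Open Scope ring_scope.

Section Polyhedra.

Variables (R : realType) (V : lmodType R).
Implicit Types (S P F : set V) (f : V -> R) (b : R) (d : int).

Definition convex_hull S : set V :=
  [set x | exists (k : nat) (v : 'I_k -> V) (w : 'I_k -> R),
      [/\ forall j, S (v j), forall j, 0 <= w j, \sum_j w j = 1
        & x = \sum_j w j *: v j]].

Definition affinely_independent (k : nat) (v : 'I_k -> V) : Prop :=
  forall w : 'I_k -> R,
    \sum_j w j = 0 -> \sum_j w j *: v j = 0 -> forall j, w j = 0.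

(* k is the largest number of affinely independent points of S; in particular
   the empty set has dimension -1. *)
Definition has_dim S d : Prop :=
  exists k : nat,
    [/\ d = k%:Z - 1,
        exists v : 'I_k -> V, (forall j, S (v j)) /\ affinely_independent v
      & forall (l : nat) (v : 'I_l -> V),
          (forall j, S (v j)) -> affinely_independent v -> (l <= k)%N].

Definition valid_inequality P f b : Prop := forall x, P x -> f x <= b.

Definition induced_face P f b : set V := P `&` [set x | f x = b].

(* f is meant to be linear. *)
Definition induces_facet P f b : Prop :=
  valid_inequality P f b /\
  exists d, has_dim P d /\ has_dim (induced_face P f b) (d - 1).

End Polyhedra.

Section PathPolytope.

Variables (R : realType) (n : nat).

Definition node := 'I_n.+1.

Definition internal (i : node) : bool := (0 < i < n)%N.

(* ord0 is the node 0 and ord_max is the node n. *)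
Definition is_arc (i j : node) : bool :=
  [|| (i == ord0) && internal j,
      internal i && (j == ord_max)
    | [&& internal i, internal j & i != j]].

Definition arc := {a : node * node | is_arc a.1 a.2}.

(* R^A; the codomain is R^o so that it is an lmodType R. *)
Definition arc_vector := {ffun arc -> R^o}.

(* A path is given by the list p of its nodes other than the initial node 0, so
   that size p is its number of arcs. *)
Definition simple_0n_path (p : seq node) : bool :=
  [&& path is_arc ord0 p, uniq (ord0 :: p) & last ord0 p == ord_max].

Definition path_arcs (p : seq node) : seq (node * node) := zip (ord0 :: p) p.

Definition incidence_vector (p : seq node) : arc_vector :=
  [ffun a : arc => (val a \in path_arcs p)%:R].

Definition path_polytope (c : seq nat) : set arc_vector :=
  convex_hull [set x | exists p : seq node,
    [/\ simple_0n_path p, size p \in c & x = incidence_vector p]].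

Definition delta_out (i : node) : {set arc} := [set a : arc | (val a).1 == i]%SET.

Definition arc_sum (A : {set arc}) (x : arc_vector) : R := \sum_(a in A) x a.

End PathPolytope.

Arguments path_polytope R n c : clear implicits.
Arguments arc_sum R {n} A x.

(* Main.v *)
From HB Require Import structures.
From Pilot Require Import Defs.
From mathcomp Require Import all_boot all_order all_algebra.
From mathcomp Require Import classical_sets reals.
From mathcomp Require Import zify ring lra.

Set Implicit Arguments.
Unset Strict Implicit.
Unset Printing Implicit Defensive.

Import Order.TTheory GRing.Theory Num.Theory.
Local Open Scope ring_scope.

(** The facet property amounts to: arc costs that are constant on the feasible
    paths through [i] are also constant on the feasible paths avoiding [i].
    Adding a potential difference to the costs, one may assume that the arc
    from [0] to [i] and all arcs leaving [i] cost nothing. Comparing paths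
    through [i] that differ in one or two nodes then shows that all arcs leaving
    [0] for some [j != i] have the same cost, that all arcs entering [n] from
    such a [j] have the same cost, and that arcs between two such nodes cost
    nothing. The comparison uses either an admissible length [k] with
    [4 <= k < n], which leaves a spare node for exchanges, and a second length,
    or the lengths [3] and [n]. *)

(** * Costs of walks in a set of nodes *)

Section WalkCost.

Variables (R : realFieldType) (T : eqType).
Implicit Types (b : T -> T -> R) (x : T) (s : seq T).

Fixpoint walk_cost b x s : R :=
  if s is y :: s' then b x y + walk_cost b y s' else 0.

Lemma walk_cost_cat b x s1 s2 :
  walk_cost b x (s1 ++ s2) = walk_cost b x s1 + walk_cost b (last x s1) s2.
Proof. by elim: s1 x => [|y s1 IH] x /=; rewrite ?add0r // IH addrA. Qed.

Lemma walk_cost_rcons b x s y :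
  walk_cost b x (rcons s y) = walk_cost b x s + b (last x s) y.
Proof. by rewrite -cats1 walk_cost_cat /= addr0. Qed.

(** The potential telescopes along the walk, so only its values at the two ends survive. *)
Lemma walk_cost_potential b (pi : T -> R) x s :
  walk_cost (fun u v => b u v + pi u - pi v) x s
  = walk_cost b x s + pi x - pi (last x s).
Proof. by elim: s x => [|y s IH] x /=; [ring|rewrite IH; ring]. Qed.

Lemma walk_cost_const b (J : seq T) v x s :
    {in J &, forall j k, j != k -> b j k = v} ->
  uniq (x :: s) -> {subset x :: s <= J} -> walk_cost b x s = v *+ size s.
Proof.
move=> bJ; elim: s x => [|y s IH] x //= /andP[xNys ys_uniq] sJ.
have [xJ yJ] : x \in J /\ y \in J by split; apply: sJ; rewrite !inE eqxx ?orbT.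
rewrite IH // ?mulrS => [|z zs]; last by apply: sJ; rewrite inE zs orbT.
by rewrite bJ //; apply: contraNneq xNys => ->; rewrite inE eqxx.
Qed.

End WalkCost.

(** Supplies the filler nodes that bring a path to a prescribed length. Since [J] has no duplicates,
    at most [size X] of its entries lie in [X]. *)
Lemma seq_avoiding (T : eqType) (J X : seq T) m :
    uniq J -> (m + size X <= size J)%N ->
  exists D, [/\ uniq D, size D = m, {subset D <= J}
              & {in D, forall x, x \notin X}].
Proof.
move=> J_uniq le_mX; exists (take m [seq x <- J | x \notin X]); split.
- by rewrite take_uniq ?filter_uniq.
- rewrite size_takel // size_filter.
  have : (count (mem X) J <= size X)%N.
    rewrite -size_filter; apply: uniq_leq_size => [|x]; rewrite ?filter_uniq //.
    by rewrite mem_filter => /andP[].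
  have := count_predC (mem X) J; have -> : count (predC (mem X)) J
    = count [pred x | x \notin X] J by [].
  by move: (count _ _) (count _ _) => p q; lia.
- by move=> x /mem_take; rewrite mem_filter => /andP[].
- by move=> x /mem_take; rewrite mem_filter => /andP[].
Qed.

(** * Normalised arc costs that are constant on paths through [i] *)

Section NormalisedCost.

Variables (R : realFieldType) (T : eqType) (o t i : T) (J : seq T).
Variables (b : T -> T -> R) (beta : R).
Hypothesis J_uniq : uniq J.
Hypothesis boi : b o i = 0.
Hypothesis bit : b i t = 0.
Hypothesis biJ : {in J, forall j, b i j = 0}.

(** [A] and [B] are the nodes visited before and after [i]. The parameter [k] counts the inner nodes
    other than [i], so the paths concerned have [k + 2] arcs. *)
Definition const_through k := forall A B : seq T,
  uniq (A ++ B) -> {subset A ++ B <= J} -> (size A + size B)%N = k ->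
  walk_cost b o (A ++ i :: rcons B t) = beta.

(** Compare the paths [o, i, j, l, D, t] and [o, j, i, l, D, t]: arcs leaving [i] and the arc from
    [o] to [i] are free, and the part from [l] on is shared. *)
Lemma const_through_inner k : const_through k -> (2 <= k <= size J)%N ->
  {in J &, forall j l, j != l -> b j l = b o j + b j i}.
Proof.
move=> Hk /andP[k2 kJ] j l jJ lJ jl.
have [|D [uD sD DJ DX]] := @seq_avoiding _ J [:: j; l] (k - 2) J_uniq.
  by rewrite /=; lia.
have jD : j \notin D by apply/negP => /DX; rewrite !inE eqxx.
have lD : l \notin D by apply/negP => /DX; rewrite !inE eqxx orbT.
have U : uniq [:: j, l & D] by rewrite /= inE negb_or jl jD lD.
have S : {subset [:: j, l & D] <= J}.
  by move=> x; rewrite !inE => /or3P[/eqP->|/eqP->|/DJ].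
have Z : (size D).+2 = k by rewrite sD -addn2 subnK.
have := Hk [::] [:: j, l & D] U S Z; have := Hk [:: j] [:: l & D] U S Z.
by rewrite /= boi !biJ // => <- /eqP; rewrite -subr_eq0 => /eqP E; lra.
Qed.

(** As [k] is smaller than [size J], one node of [J] can stay unvisited, so [j] may be replaced by
    [j'] in a path with all other nodes fixed. The three equations come from three positions of the
    replaced node. *)
Lemma const_through_spare k : const_through k -> (2 <= k < size J)%N ->
  forall j j', j \in J -> j' \in J ->
  [/\ b o j + b j i = b o j' + b j' i, b o j = b o j' & b j t = b j' t].
Proof.
move=> Hk /andP[k2 kJ] j j' jJ j'J.
have [->//|jj'] := eqVneq j j'.
have inner := @const_through_inner k Hk; rewrite k2 ltnW // in inner.
have {}inner := inner isT.
have [|[|l L] [_ /= sL LJ LX]] := @seq_avoiding _ J [:: j; j'] 1 J_uniq.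
- by rewrite /=; lia.
- by [].
have lJ : l \in J by apply: LJ; rewrite inE eqxx.
have := LX l; rewrite !inE eqxx negb_or => /(_ isT) /andP[lj lj'] {LX LJ sL}.
have [|D [uD sD DJ DX]] := @seq_avoiding _ J [:: j; j'; l] (k - 2) J_uniq.
  by rewrite /=; lia.
have jD : j \notin D by apply/negP => /DX; rewrite !inE eqxx.
have j'D : j' \notin D by apply/negP => /DX; rewrite !inE eqxx orbT.
have lD : l \notin D by apply/negP => /DX; rewrite !inE eqxx !orbT.
have U : uniq [:: j, l & D] by rewrite /= inE negb_or eq_sym lj jD lD.
have U' : uniq [:: j', l & D] by rewrite /= inE negb_or eq_sym lj' j'D lD.
have S : {subset [:: j, l & D] <= J}.
  by move=> x; rewrite !inE => /or3P[/eqP->|/eqP->|/DJ].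
have S' : {subset [:: j', l & D] <= J}.
  by move=> x; rewrite !inE => /or3P[/eqP->|/eqP->|/DJ].
have Z : (size D).+2 = k by rewrite sD -addn2 subnK.
(* Exchange in [o, j, i, l, D, t]. *)
have aju : b o j + b j i = b o j' + b j' i.
  have := Hk [:: j] [:: l & D] U S Z; have := Hk [:: j'] [:: l & D] U' S' Z.
  by rewrite /= !biJ // => <- E; lra.
split=> //.
(* Exchange in [o, j, l, D, i, t]. By [inner] and [aju] the arcs from [j] and [j'] to [l] cost the
   same, which leaves the arcs from [o]. *)
- have Z' : ((size D).+2 + 0)%N = k by rewrite addn0.
  have := Hk [:: j, l & D] [::]; have := Hk [:: j', l & D] [::].
  rewrite !cats0 => /(_ U' S' Z') E' /(_ U S Z') E.
  move: E E'; rewrite /= (inner j l) ?(inner j' l) 1?eq_sym // => <- E; lra.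
(* Exchange in [o, l, D, i, j, t], where the arc entering [j] is free. *)
- have P x : perm_eq ((l :: D) ++ [:: x]) [:: x, l & D].
    by rewrite cats1 perm_rcons.
  have Z' : ((size D).+1 + 1)%N = k by rewrite addn1.
  have := Hk (l :: D) [:: j]; have := Hk (l :: D) [:: j'].
  rewrite (perm_uniq (P j)) (perm_uniq (P j')) => /(_ U') E' /(_ U) E.
  have /E' /(_ Z') : {subset (l :: D) ++ [:: j'] <= J}.
    by move=> x; rewrite (perm_mem (P j')) => /S'.
  have /E /(_ Z') : {subset (l :: D) ++ [:: j] <= J}.
    by move=> x; rewrite (perm_mem (P j)) => /S.
  by rewrite !walk_cost_cat /= !biJ // => <- E0; lra.
Qed.


Definition flat_cost := exists a z : R, [/\ {in J, forall j, b o j = a},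
  {in J, forall j, b j t = z} & {in J &, forall j l, j != l -> b j l = 0}].

(** Such a path pays once for leaving [o] and once for entering [t], and nothing in between, hence
    [a + z]. A nonempty [s] excludes the direct step from [o] to [t]. *)
Lemma walk_cost_flat : flat_cost -> exists g : R, forall s,
  s != [::] -> uniq s -> {subset s <= J} -> walk_cost b o (rcons s t) = g.
Proof.
move=> [a [z [boJ bJt bJJ]]]; exists (a + z) => -[//|x s] _ s_uniq sJ.
rewrite rcons_cons /= walk_cost_rcons (walk_cost_const bJJ) // mul0rn.
by rewrite boJ ?bJt ?add0r //; apply: sJ; rewrite ?mem_last // mem_head.
Qed.

(** The exchanges leave three unknowns: [a], [z] and the common cost [v] of arcs inside [J]. Placing
    [i] first or last on a path determines [z], and the second length forces [v = 0]. *)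
Lemma flat_cost_spare k k' : const_through k -> (2 <= k < size J)%N ->
  const_through k' -> (k' <= size J)%N -> k' != k -> flat_cost.
Proof.
move=> Hk k_range Hk' k'J k'k.
have inner := @const_through_inner k Hk; move: (k_range) => /andP[k2 kJ].
rewrite k2 ltnW // in inner; have {}inner := inner isT.
have spare := const_through_spare Hk k_range.
have [j0 j0J] : exists j0, j0 \in J.
  by case: (J) kJ => [//|j0 J' _]; exists j0; rewrite mem_head.
pose v := b o j0 + b j0 i; pose a := b o j0; pose z := b j0 t.
have bo j : j \in J -> b o j = a by move=> jJ; case: (spare j j0 jJ j0J).
have bt j : j \in J -> b j t = z by move=> jJ; case: (spare j j0 jJ j0J).
have bi j : j \in J -> b j i = v - a.
  move=> jJ; case: (spare j j0 jJ j0J) => E1 E2 _.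
  by rewrite /v -E1 /a -E2 addrC addKr.
have bv : {in J &, forall j l, j != l -> b j l = v}.
  by move=> j l jJ lJ jl; rewrite inner // bo // bi // addrC subrK.
(* Put [i] directly after [o]: the first two arcs are free, then come [m - 1] arcs inside [J] and
   one arc into [t]. *)
have right m : const_through m -> (0 < m <= size J)%N -> v *+ m.-1 + z = beta.
  move=> Hm /andP[m0 mJ].
  have [|[|x D] [uD /= sD DJ _]] := @seq_avoiding _ J [::] m J_uniq.
  - by rewrite addn0.
  - by move: m0; rewrite -sD.
  have := Hm [::] (x :: D) uD DJ sD.
  have xJ : x \in J by apply: DJ; rewrite mem_head.
  rewrite /= boi biJ // !add0r walk_cost_rcons (walk_cost_const bv) //.
  by rewrite bt -?sD //; apply: DJ; apply: mem_last.
(* Put [i] directly before [t]: the cost is [a], then [v] for each of [k - 1] arcs, then [v - a]. *)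
have left_k : v *+ k = beta.
  have [|[|x D] [uD /= sD DJ _]] := @seq_avoiding _ J [::] k J_uniq.
  - by rewrite addn0 ltnW.
  - by move: k2; rewrite -sD.
  have xJ : x \in J by apply: DJ; rewrite mem_head.
  have := Hk (x :: D) [::]; rewrite cats0 addn0 => /(_ uD DJ sD).
  rewrite /= walk_cost_cat /= bit !addr0 (walk_cost_const bv) // bo //.
  rewrite bi; last by apply: DJ; apply: mem_last.
  by rewrite -sD mulrS => <-; ring.
have zv : z = v.
  have : v *+ k.-1 + z = beta by apply: right => //; lia.
  by rewrite -left_k -[in RHS](prednK (ltnW k2)) mulrSr => /addrI.
(* For [k' = 0] the only path is [o, i, t], which is free, so [beta = 0]. *)
have kk' : v *+ k' = beta.
  case: k' Hk' k'J {k'k} => [|m] Hm mJ.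
    by rewrite -(Hm [::] [::]) //= boi bit !addr0.
  by rewrite -(right _ Hm) //= zv mulrSr.
have v0 : v = 0.
  have : v * (k'%:R - k%:R) = 0 by rewrite mulrBr !mulr_natr kk' left_k subrr.
  by move=> /eqP; rewrite mulf_eq0 subr_eq0 eqr_nat (negPf k'k) orbF => /eqP.
by exists a, z; split=> // j l jJ lJ jl; rewrite bv.
Qed.

(** No node is spare at length [size J], but the paths with a single node besides [i] already fix
    the arcs into [t] and the sums [b o j + b j i]. *)
Lemma flat_cost_hamiltonian : (2 <= size J)%N ->
  const_through 1 -> const_through (size J) -> flat_cost.
Proof.
move=> J2 H1 HJ.
have inner := @const_through_inner _ HJ; rewrite J2 leqnn in inner.
have {}inner := inner isT.
have S1 j : j \in J -> {subset [:: j] <= J} by move=> jJ x; rewrite inE => /eqP->.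
have bt j : j \in J -> b j t = beta.
  move=> jJ; rewrite -(H1 [::] [:: j]) //=; last exact: S1.
  by rewrite boi biJ // addr0 !add0r.
have bi j : j \in J -> b o j + b j i = beta.
  move=> jJ; rewrite -(H1 [:: j] [::]) //=; last exact: S1.
  by rewrite bit !addr0.
have bv : {in J &, forall j l, j != l -> b j l = beta}.
  by move=> j l jJ lJ jl; rewrite inner // bi.
(* The path [o, i, J, t] has [size J - 1] arcs inside [J] and one into [t], all of cost [beta],
   while its total is [beta]. Since [size J] is at least 2, this forces [beta = 0]. *)
have beta0 : beta = 0.
  have [x [D EJ]] : exists x D, J = x :: D.
    by case: (J) J2 => // x D; exists x, D.
  have xJ : x \in J by rewrite EJ mem_head.
  have := HJ [::] J J_uniq (fun x => id) erefl; rewrite {1}EJ.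
  rewrite /= boi biJ // !add0r walk_cost_rcons.
  have U : uniq (x :: D) by rewrite -EJ.
  have S : {subset x :: D <= J} by rewrite EJ.
  rewrite (walk_cost_const bv U S) bt ?S ?mem_last // => E.
  have /eqP : beta *+ size D = 0 by apply: (addIr beta); rewrite E add0r.
  by rewrite mulrn_eq0 => /orP[/eqP D0|/eqP//]; move: J2; rewrite EJ /= D0.
have bo j l : j \in J -> l \in J -> b o j = b o l.
  move=> jJ lJ; have [->//|jl] := eqVneq j l.
  (* The path [o, j, D, l, i, t] visits all of [J]. Its arcs inside [J] are free, so
     [b o j + b l i = beta]; comparison with [bi l] gives the claim. *)
  have [|D [uD sD DJ DX]] := @seq_avoiding _ J [:: j; l] (size J - 2) J_uniq.
    by rewrite /=; lia.
  have jD : j \notin D by apply/negP => /DX; rewrite !inE eqxx.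
  have lD : l \notin D by apply/negP => /DX; rewrite !inE eqxx orbT.
  have U : uniq (rcons (j :: D) l).
    by rewrite rcons_uniq /= inE negb_or eq_sym jl jD lD uD.
  have S : {subset rcons (j :: D) l <= J}.
    by move=> x; rewrite mem_rcons !inE => /or3P[/eqP->|/eqP->|/DJ].
  have := HJ (rcons (j :: D) l) [::]; rewrite cats0 addn0 size_rcons /=.
  have Z : (size D).+2 = size J by rewrite sD -addn2 subnK.
  move=> /(_ U S Z).
  rewrite walk_cost_cat /= bit !addr0 last_rcons.
  have := walk_cost_const bv U S; rewrite beta0 mul0rn => ->.
  by rewrite add0r -beta0 -(bi l lJ) => /addIr.
have [j0 j0J] : exists j0, j0 \in J.
  by case: (J) J2 => [//|j0 J' _]; exists j0; rewrite mem_head.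
exists (b o j0), beta; split=> // [j jJ|j l jJ lJ jl]; first exact: bo.
by rewrite bv.
Qed.

End NormalisedCost.

(** * Linear algebra: facets of convex hulls by homogenisation *)

(** Remove from a vector its projection to [W]: the remainder of [u] is nonzero, so one of its
    coordinates is, and that coordinate of the remainder is the functional. *)
Lemma separating_functional (F : fieldType) (U : vectType F) (W : {vspace U}) u :
  u \notin W ->
  exists phi : {linear U -> F^o}, {in W, forall w, phi w = 0} /\ phi u != 0.
Proof.
move=> uNW; pose r := (\1 - projv W)%VF : 'End(U).
have ru : r u != 0.
  apply: contraNneq uNW; rewrite /r !lfunE /= !lfunE /= => /eqP.
  rewrite subr_eq0 => /eqP ->; exact: memv_proj.
have [j rj] : exists j, coord (vbasis fullv) j (r u) != 0.
  apply/existsP; apply: contraNT ru; rewrite negb_exists => /forallP r0.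
  rewrite (coord_vbasis (memvf (r u))) big1 // => j _.
  by have := r0 j; rewrite negbK => /eqP ->; rewrite scale0r.
exists (coord (vbasis fullv) j \o r); split=> // w wW /=.
by rewrite /r !lfunE /= !lfunE /= projv_id // subrr linear0.
Qed.

Section Homogenisation.

Variables (R : realType) (V : vectType R).
Implicit Types (X : seq V) (S : set V).

(** Placing points at height 1 turns affine independence into linear independence, so dimensions can
    be computed with spans. *)
Definition lift_pt (x : V) : V * R^o := (x, 1).

Lemma sum_lift_pt k (w : 'I_k -> R) (v : 'I_k -> V) :
  \sum_j w j *: lift_pt (v j) = (\sum_j w j *: v j, \sum_j w j).
Proof.
rewrite [LHS]surjective_pairing; congr pair.
  by rewrite (raddf_sum fst).
by rewrite (raddf_sum snd) /=; apply: eq_bigr => j _; rewrite /GRing.scale /= mulr1.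
Qed.

Lemma affinely_independentP k (v : 'I_k -> V) :
  affinely_independent v <-> free [tuple lift_pt (v j) | j < k].
Proof.
split=> [indep|/freeP fr w w0 wv0 j].
  apply/freeP => w; under eq_bigr do rewrite -tnth_nth tnth_mktuple.
  by rewrite sum_lift_pt => -[wv0 w0]; apply: indep.
apply: fr; under eq_bigr do rewrite -tnth_nth tnth_mktuple.
by rewrite sum_lift_pt w0 wv0.
Qed.

(** Extracts a basis of the span that consists of lifted points of [X] themselves; the dimension
    must be attained by actual points. *)
Lemma free_subfamily X : exists Y, [/\ {subset Y <= X}, free (map lift_pt Y)
  & <<map lift_pt Y>>%VS = <<map lift_pt X>>%VS].
Proof.
elim: X => [|x X [Y [YX fY sY]]]; first by exists [::]; split; rewrite ?nil_free.
have [xY|xY] := boolP (lift_pt x \in <<map lift_pt Y>>%VS).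
  exists Y; split=> // [y /YX|]; first by rewrite inE orbC => ->.
  rewrite /= span_cons -sY; apply/esym/addv_idPr.
  by rewrite -memvE.
exists (x :: Y); split; last by rewrite /= !span_cons sY.
  by move=> y; rewrite !inE => /orP[->//|/YX ->]; rewrite orbT.
by rewrite /= free_cons xY.
Qed.

Lemma has_dim_span S X : (forall x, x \in X -> S x) ->
  (forall x, S x -> lift_pt x \in <<map lift_pt X>>%VS) ->
  has_dim S ((\dim <<map lift_pt X>>%VS)%:Z - 1).
Proof.
move=> XS SX; have [Y [YX fY sY]] := free_subfamily X.
have dimY : \dim <<map lift_pt X>>%VS = size Y.
  by rewrite -sY (eqP fY) size_map.
exists (size Y); split; first by rewrite dimY.
  exists (tnth (in_tuple Y)); split=> [j|]; first by apply/XS/YX/mem_tnth.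
  apply/affinely_independentP; suff -> : [tuple lift_pt (tnth (in_tuple Y) j) | j < size Y]
    = map lift_pt Y :> seq _ by [].
  by rewrite -[Y in RHS]/(tval (in_tuple Y)) -[in RHS](map_tnth_enum (in_tuple Y)) -map_comp.
move=> l v vS /affinely_independentP /eqP fv.
rewrite -dimY; have <- : size [tuple lift_pt (v j) | j < l] = l by rewrite size_tuple.
rewrite -fv dimvS //; apply/span_subvP => y /mapP[j _ ->]; exact/SX/vS.
Qed.

Lemma convex_hull_sub S x : S x -> convex_hull S x.
Proof.
move=> Sx; exists 1%N, (fun=> x), (fun=> 1); split=> //.
- by rewrite big_ord1.
- by rewrite big_ord1 scale1r.
Qed.

Lemma lift_convex_hull S (W : {vspace V * R^o}) x :
  (forall y, S y -> lift_pt y \in W) -> convex_hull S x -> lift_pt x \in W.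
Proof.
move=> SW [k [v [w [vS _ w1 ->]]]].
have -> : lift_pt (\sum_j w j *: v j) = \sum_j w j *: lift_pt (v j).
  by rewrite sum_lift_pt w1.
by apply: memv_suml => j _; apply/memvZ/SW.
Qed.

(** Modulo the span of the lifted face, all vertices off the face agree with [x0]. So [lift_pt x0]
    alone extends that span to the span of all vertices, and the dimension drops by exactly one. *)
Lemma induces_facet_hull S X (f : {linear V -> R^o}) (beta : R) x0 :
    (forall x, S x <-> x \in X) ->
    {in X, forall x, f x <= beta} -> x0 \in X -> f x0 < beta ->
    {in X, forall x, f x < beta ->
      lift_pt x - lift_pt x0 \in <<map lift_pt [seq y <- X | f y == beta]>>%VS} ->
  induces_facet (convex_hull S) f beta.
Proof.
set XF := [seq _ <- _ | _] => SX f_le x0X fx0 diffF.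
set WF := <<map lift_pt XF>>%VS in diffF *.
have valid : valid_inequality (convex_hull S) f beta.
  move=> x [k [v [w [vS w_ge0 w1 ->]]]]; rewrite linear_sum.
  rewrite -[beta]mul1r -w1 mulr_suml ler_sum // => j _.
  by rewrite linearZ /= ler_wpM2l // f_le //; apply/SX.
have dimP : \dim <<map lift_pt X>>%VS = (\dim WF).+1.
  have x0NW : lift_pt x0 \notin WF.
    apply/negP => x0W.
    (* The homogenised inequality vanishes on the lifted face and is negative at [x0]. *)
    pose psi : {linear (V * R^o)%type -> R^o} := (f \o fst) \- (beta \*: snd).
    have psiE x : psi (lift_pt x) = f x - beta by rewrite /= /GRing.scale /= mulr1.
    have /subvP/(_ _ x0W) : (WF <= lker (linfun psi))%VS.
      apply/span_subvP => _ /mapP[x + ->]; rewrite mem_filter => /andP[/eqP fx _].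
      by rewrite memv_ker lfunE psiE fx subrr.
    by rewrite memv_ker lfunE psiE subr_eq0 => /eqP fx; rewrite fx ltxx in fx0.
  have -> : <<map lift_pt X>>%VS = (WF + <[lift_pt x0]>)%VS.
    apply: subv_anti; apply/andP; split.
      apply/span_subvP => _ /mapP[x xX ->].
      have [fx|] := ltP (f x) beta.
        by rewrite -[lift_pt x](subrK (lift_pt x0)) memv_add ?memv_line ?diffF.
      move=> fx; rewrite -[lift_pt x]addr0 memv_add ?mem0v // memv_span // map_f //.
      by rewrite mem_filter xX andbT eq_le fx f_le.
    rewrite subv_add -memvE memv_span ?map_f // andbT sub_span // => _ /mapP[x + ->].
    by rewrite mem_filter => /andP[_ xX]; rewrite map_f.
  have lift0 : lift_pt x0 != 0 by apply: contraNneq x0NW => ->; rewrite mem0v.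
  rewrite dimv_disjoint_sum ?dim_vline ?lift0 ?addn1 //.
  apply/eqP; rewrite -subv0; apply/subvP => u /memv_capP[uW /vlineP[k uk]].
  rewrite memv0 uk; have [->|k0] := eqVneq k 0; first by rewrite scale0r.
  by case/negP: x0NW; rewrite -[lift_pt x0](scalerK k0) -uk memvZ.
split=> //; exists ((\dim <<map lift_pt X>>%VS)%:Z - 1); split.
  apply: has_dim_span => [x xX|x]; first exact/convex_hull_sub/SX.
  apply: lift_convex_hull => y /SX yX; apply: memv_span; exact: map_f.
rewrite dimP; have -> : (\dim WF).+1%:Z - 1 - 1 = (\dim WF)%:Z - 1 by lia.
apply: has_dim_span => [x|x [Px fx]].
  rewrite mem_filter => /andP[/eqP fx xX]; split=> //.
  exact/convex_hull_sub/SX.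
case: Px fx => k [v [w [vS w_ge0 w1 ->]]] /= fx.
have -> : lift_pt (\sum_j w j *: v j) = \sum_j w j *: lift_pt (v j).
  by rewrite sum_lift_pt w1.
(* The weighted gaps are nonnegative and sum to zero on the face, so every vertex with nonzero
   weight lies on the face. *)
have gap_ge0 j : 0 <= w j * (beta - f (v j)).
  by rewrite mulr_ge0 // subr_ge0 f_le //; apply/SX.
have : \sum_j w j * (beta - f (v j)) = 0.
  under eq_bigr do rewrite mulrBr.
  rewrite sumrB -mulr_suml w1 mul1r -fx linear_sum.
  by under [X in _ - X]eq_bigr do rewrite -[_ * _]linearZ; rewrite subrr.
move=> /eqP; rewrite psumr_eq0 // => /allP gap0.
apply: memv_suml => j _; have := gap0 j (mem_index_enum j).
rewrite /= mulf_eq0 subr_eq0 => /orP[/eqP ->|/eqP fj]; first by rewrite scale0r mem0v.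
by rewrite memvZ // memv_span // map_f // mem_filter -fj eqxx; apply/SX.
Qed.

End Homogenisation.

(** * Paths and their incidence vectors *)

Section PathIncidence.

Variables (R : realType) (n : nat).
Implicit Types (p s : seq (node n)) (i j : node n).

Lemma internalE j : internal j = (j != ord0) && (j != ord_max).
Proof.
rewrite /internal lt0n -!val_eqE /=; congr andb.
by have := ltn_ord j; rewrite ltnS leq_eqVlt; case: eqVneq => //= ->; rewrite ltnn.
Qed.

Lemma path_internal x s : internal x -> uniq (x :: s) -> all (@internal n) s ->
  path (@is_arc n) x (rcons s ord_max).
Proof.
elim: s x => [|y s IH] x xin /=; first by rewrite /is_arc xin eqxx !orbT.
move=> /andP[xNys ys_uniq] /andP[yin sin]; rewrite IH // andbT /is_arc xin yin.
by move: xNys; rewrite inE negb_or => /andP[-> _]; rewrite !orbT.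
Qed.

(** Any two distinct internal nodes are joined by arcs, so the inner nodes may come in any order.
    There is at least one, because no arc joins the two end nodes directly. *)
Lemma simple_0n_pathP p : (0 < n)%N -> simple_0n_path p <->
  exists s, [/\ p = rcons s ord_max, s != [::], uniq s & all (@internal n) s].
Proof.
move=> n_gt0; have max0 : (ord_max : node n) != ord0 by rewrite -val_eqE /= -lt0n.
split=> [|[s [-> s0 us sin]]].
  case/lastP: p => [|s x]; first by rewrite /simple_0n_path /= eq_sym (negPf max0).
  move=> /and3P[sP]; rewrite last_rcons => + /eqP E; rewrite {}E in sP *.
  rewrite cons_uniq mem_rcons inE negb_or rcons_uniq => /andP[/andP[_ s0] /andP[sm us]].
  exists s; split=> //; last first.
    apply/allP => y ys; rewrite internalE; apply/andP.
    by split; [apply: contraNneq s0 => <-|apply: contraNneq sm => <-].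
  by apply: contraTneq sP => ->; rewrite /= /is_arc !internalE !eqxx /= andbF.
have [s0' sm] : ord0 \notin s /\ ord_max \notin s.
  by split; apply/negP => /(allP sin); rewrite internalE eqxx ?andbF.
rewrite /simple_0n_path last_rcons eqxx andbT cons_uniq mem_rcons inE negb_or.
rewrite eq_sym max0 s0' rcons_uniq sm us !andbT /=.
case: s s0 us sin {s0' sm} => [//|x s] _ us /= /andP[xin sin].
by rewrite path_internal // andbT /is_arc eqxx xin.
Qed.

Lemma walk_cost_zip (g : node n * node n -> R) x s :
  walk_cost (fun u v => g (u, v)) x s = \sum_(e <- zip (x :: s) s) g e.
Proof. by elim: s x => [|y s IH] x /=; rewrite ?big_nil // big_cons IH. Qed.

(** The heads of the arcs are the entries of [p], which are distinct. *)
Lemma uniq_path_arcs p : uniq p -> uniq (path_arcs p).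
Proof.
by move=> up; apply: (@map_uniq _ _ snd); rewrite -/(unzip2 _) unzip2_zip //=.
Qed.

Lemma path_arcs_arc p : path (@is_arc n) ord0 p ->
  {in path_arcs p, forall e, is_arc e.1 e.2}.
Proof.
rewrite /path_arcs; elim: p ord0 => [//|y p IH] x /= /andP[xy yp] e.
by rewrite inE => /orP[/eqP -> //|]; apply: IH.
Qed.

Lemma sum_incidence (g : node n * node n -> R) p : simple_0n_path p ->
  \sum_(a : Defs.arc n) incidence_vector R p a * g (val a)
  = walk_cost (fun u v => g (u, v)) ord0 p.
Proof.
move=> /and3P[pP]; rewrite cons_uniq => /andP[_ up] _.
rewrite walk_cost_zip -/(path_arcs p) [RHS]big_uniq ?uniq_path_arcs //=.
(* All pairs on the path are arcs, so the sum over pairs can be reindexed by the subtype of arcs. *)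
have arcP e : e \in path_arcs p -> omap val (insub e : option (Defs.arc n)) = Some e.
  by move=> ep; rewrite insubT ?(path_arcs_arc pP).
rewrite [RHS](reindex_omap _ _ arcP).
rewrite big_mkcond [RHS]big_mkcond /=; apply: eq_bigr => a _.
by rewrite ffunE valK eqxx andbT; case: ifP; rewrite ?mul1r ?mul0r.
Qed.

Lemma walk_cost_out_degree i x s :
  walk_cost (fun u _ => (u == i)%:R : R) x s = (count_mem i (belast x s))%:R.
Proof. by elim: s x => [//|y s IH] x /=; rewrite IH natrD. Qed.

(** A simple path leaves each of its nodes except the last exactly once, and [i] is not the last. *)
Lemma arc_sum_incidence i p : internal i -> simple_0n_path p ->
  arc_sum R (delta_out i) (incidence_vector R p) = (i \in p)%:R.
Proof.
move=> iin pP.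
have n_gt0 : (0 < n)%N by case/andP: iin; apply: ltn_trans.
move: iin; rewrite internalE => /andP[i0 im].
have <- : walk_cost (fun u _ => (u == i)%:R : R) ord0 p = (i \in p)%:R.
  case/(simple_0n_pathP _ n_gt0): pP => s [-> _ us _].
  rewrite walk_cost_out_degree belast_rcons /= eq_sym (negPf i0) add0n.
  by rewrite count_uniq_mem // mem_rcons inE (negPf im).
rewrite -(sum_incidence (fun e => (e.1 == i)%:R)) // /arc_sum big_mkcond /=.
by apply: eq_bigr => a _; rewrite inE; case: ifP; rewrite ?mulr1 ?mulr0.
Qed.

Fact arc_sum_linear (A : {set Defs.arc n}) :
  linear (arc_sum R A : arc_vector R n -> R^o).
Proof.
move=> k x y; rewrite /arc_sum scaler_sumr -big_split /=.
by apply: eq_bigr => a _; rewrite !ffunE.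
Qed.

HB.instance Definition _ (A : {set Defs.arc n}) := GRing.isLinear.Build R
  (arc_vector R n) R^o _ (arc_sum R A) (arc_sum_linear A).

(** The cost of an arc is the value of [phi] at its unit vector at height 0; [d] is the value at the
    origin lifted to height 1. *)
Lemma linear_arc_vectorE (phi : {linear (arc_vector R n * R^o)%type -> R^o}) :
  exists (b : node n -> node n -> R) (d : R), forall p, simple_0n_path p ->
  phi (lift_pt (incidence_vector R p)) = walk_cost b ord0 p + d.
Proof.
pose delta (a : Defs.arc n) : arc_vector R n := [ffun a' => (a' == a)%:R].
(* Pairs that are not arcs get the default cost 0; no such pair occurs on a path. *)
pose g e := if insub e is Some a then phi (delta a, 0) : R else 0.
exists (fun u v => g (u, v)), (phi (0, 1)) => p pP.
rewrite -sum_incidence //; set x := incidence_vector R p.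
have -> : lift_pt x = \sum_a x a *: (delta a, 0) + (0, 1).
  rewrite [RHS]surjective_pairing /= (raddf_sum fst) (raddf_sum snd) /= addr0.
  rewrite [X in (_, X + _)]big1 ?add0r => [|a _]; last by rewrite scaler0.
  congr pair; apply/ffunP => a; rewrite sum_ffunE (bigD1 a) //= big1 => [|a' a'a].
    by rewrite !ffunE eqxx addr0 /GRing.scale /= mulr1.
  by rewrite !ffunE eq_sym (negPf a'a) scaler0.
rewrite linearD linear_sum; congr (_ + _); apply: eq_bigr => a _.
by rewrite linearZ /g valK.
Qed.

(** Lists the paths explicitly, since spans are taken of finite sequences. *)
Definition paths_of_length_in (c : seq nat) : seq (seq (node n)) :=
  [seq p <- flatten [seq map val (enum {: k.-tuple (node n)}) | k <- c]
     | simple_0n_path p].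

Lemma mem_paths_of_length_in c p :
  (p \in paths_of_length_in c) = simple_0n_path p && (size p \in c).
Proof.
rewrite mem_filter; congr andb; apply/flatten_mapP/idP => [[k kc]|pc].
  by move=> /mapP[q _ ->]; rewrite size_tuple.
by exists (size p) => //; apply/mapP; exists (in_tuple p); rewrite ?mem_enum.
Qed.

End PathIncidence.

(** * From paths through [i] to paths avoiding [i] *)

(** Without an entry in the range from 4 to [n - 1], all entries are 2, 3 or [n]; the excluded pairs
    leave only [(3, n)] and [(2, 3, n)]. The two alternatives match [flat_cost_spare] and
    [flat_cost_hamiltonian]. *)
Lemma cardinality_cases n (c : seq nat) : (4 <= n)%N -> (2 <= size c)%N ->
    sorted ltn c -> (forall k, k \in c -> (2 <= k <= n)%N) ->
    c <> [:: 2%N; 3%N] -> c <> [:: 2%N; n] ->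
  (exists k k', [/\ k \in c, k' \in c, (4 <= k < n)%N & k' != k])
  \/ (3%N \in c /\ n \in c).
Proof.
case: c => [//|x [//|y c]] n4 _ /= /andP[xy yc] c_range c23 c2n.
have [/hasP[k kc k_range]|no_mid] := boolP (has (fun k => 4 <= k < n)%N [:: x, y & c]).
  left; exists k; have [kx|kx] := eqVneq k x.
    by exists y; rewrite !inE eqxx orbT kx; split; rewrite ?eqxx -?kx // kx; lia.
  by exists x; rewrite mem_head eq_sym.
right; have in3 k : k \in [:: x, y & c] -> [|| k == 2, k == 3 | k == n]%N.
  move=> kc; have := c_range k kc; have := hasPn no_mid k kc; lia.
have := in3 x (mem_head _ _); have := in3 y; rewrite !inE eqxx orbT => /(_ isT).
have := c_range y; rewrite !inE eqxx orbT => /(_ isT) yn.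
case: c yc in3 c_range c23 c2n {no_mid} => [|z c] yc in3 c_range c23 c2n y3 x3.
  have ynE : y = n.
    apply/eqP; case/or3P: y3 => /eqP Ey //; first by lia.
    by have Ex : x = 2%N by [lia]; rewrite Ex Ey in c23.
  rewrite ynE in xy y3 c2n *; rewrite !inE eqxx orbT; split=> //.
  by case/or3P: x3 => /eqP Ex; [rewrite Ex in c2n|rewrite Ex|lia].
have := c_range z; rewrite !inE eqxx !orbT => /(_ isT) zn.
have := in3 z; rewrite !inE eqxx !orbT => /(_ isT) z3.
by move: yc => /= /andP[yz _]; lia.
Qed.

Section AvoidingPaths.

Variables (R : realType) (n : nat) (c : seq nat) (i : node n).
Hypotheses (n_ge4 : (4 <= n)%N) (m_ge2 : (2 <= size c)%N).
Hypothesis c_increasing : sorted ltn c.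
Hypothesis c_range : forall k : nat, k \in c -> (2 <= k <= n)%N.
Hypotheses (c_neq23 : c <> [:: 2%N; 3%N]) (c_neq2n : c <> [:: 2%N; n]).
Hypothesis i_internal : internal i.

Let n_gt0 : (0 < n)%N := ltn_trans (isT : 0 < 3)%N n_ge4.

Definition other_nodes : seq (node n) := enum [predC [:: ord0; ord_max; i]].

Lemma mem_other_nodes j : (j \in other_nodes) = internal j && (j != i).
Proof. by rewrite mem_enum !inE !negb_or internalE andbA. Qed.

Lemma other_nodes_uniq : uniq other_nodes. Proof. exact: enum_uniq. Qed.

Lemma size_other_nodes : size other_nodes = (n - 2)%N.
Proof.
rewrite -cardE; have := cardC (mem [:: ord0; ord_max; i]).
have /card_uniqP -> /= : uniq [:: ord0; ord_max; i].
  move: i_internal; rewrite internalE => /andP[i0 im].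
  by rewrite /= !inE negb_or andbT (eq_sym ord0 i) i0 (eq_sym ord_max) im -val_eqE /= ltn_eqF.
rewrite card_ord => E; transitivity #|predC (mem [:: ord0; ord_max; i])|.
  exact: eq_card.
by rewrite -(addKn 3 #|_|) E subSS.
Qed.

Lemma walk_through_simple (A B : seq (node n)) : uniq (A ++ B) ->
  {subset A ++ B <= other_nodes} -> simple_0n_path (A ++ i :: rcons B ord_max).
Proof.
move=> uAB AB; apply/(simple_0n_pathP _ n_gt0); exists (A ++ i :: B).
have P : perm_eq (A ++ i :: B) (i :: (A ++ B)) by rewrite -cat1s perm_catCA.
split; first by rewrite rcons_cat.
- by case: (A).
- rewrite (perm_uniq P) /= uAB andbT; apply/negP => /AB.
  by rewrite mem_other_nodes eqxx andbF.
- rewrite (perm_all _ P) /= i_internal; apply/allP => x /AB.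
  by rewrite mem_other_nodes => /andP[].
Qed.

(** Provides a vertex off the face. The first cardinality is below [n] since a larger one follows,
    so its [k - 1] inner nodes fit into the [n - 2] nodes other than [i]. *)
Lemma exists_avoiding_path : exists p, [/\ simple_0n_path p, size p \in c & i \notin p].
Proof.
have [k [kc k_range]] : exists k, k \in c /\ (2 <= k < n)%N.
  case: c m_ge2 c_increasing c_range => [//|x [//|y c']] _ /= /andP[xy _] cr.
  exists x; rewrite mem_head; split=> //.
  have := cr x (mem_head _ _); have := cr y; rewrite !inE eqxx orbT => /(_ isT); lia.
have [|s [us ss sJ _]] := @seq_avoiding _ other_nodes [::] k.-1 other_nodes_uniq.
  by rewrite size_other_nodes /=; lia.
exists (rcons s ord_max); split.
- apply/(simple_0n_pathP _ n_gt0); exists s; split=> //.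
    by rewrite -size_eq0 ss; lia.
  by apply/allP => x /sJ; rewrite mem_other_nodes => /andP[].
- by rewrite size_rcons ss prednK //; lia.
- rewrite mem_rcons inE negb_or; apply/andP; split.
    by move: i_internal; rewrite internalE => /andP[].
  by apply/negP => /sJ; rewrite mem_other_nodes eqxx andbF.
Qed.

(* Adding potential differences to the costs changes all 0-n paths by the same
   amount; the potential below makes the costs of 0 -> i and of all arcs leaving
   i vanish. *)
Lemma walk_cost_avoiding (b : node n -> node n -> R) (beta : R) :
    (forall p, simple_0n_path p -> size p \in c -> i \in p ->
      walk_cost b ord0 p = beta) ->
  exists g, forall p, simple_0n_path p -> i \notin p -> walk_cost b ord0 p = g.
Proof.
move=> b_beta; pose pi x := if x == ord0 then - b ord0 i
  else if x == i then 0 else b i x.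
pose b' u v := b u v + pi u - pi v.
have [i0 im] : i != ord0 /\ i != ord_max by apply/andP; rewrite -internalE.
have max0 : (ord_max : node n) != ord0 by rewrite -val_eqE /= -lt0n.
have pi_0 : pi ord0 = - b ord0 i by rewrite /pi eqxx.
have pi_i : pi i = 0 by rewrite /pi (negPf i0) eqxx.
have pi_j j : j != ord0 -> j != i -> pi j = b i j.
  by rewrite /pi => /negPf -> /negPf ->.
have b'E p : simple_0n_path p ->
    walk_cost b' ord0 p = walk_cost b ord0 p - b ord0 i - b i ord_max.
  move=> /and3P[_ _ /eqP lp]; rewrite walk_cost_potential lp pi_0 pi_j //.
  by rewrite eq_sym.
(* Of the [k - 1] inner nodes of a path with [k] arcs, one is [i], which leaves [k - 2]. *)
have through k : k \in c -> const_through ord0 ord_max i other_nodes b'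
    (beta - b ord0 i - b i ord_max) (k - 2).
  move=> kc A B uAB AB sAB; have pP := walk_through_simple uAB AB.
  rewrite b'E // b_beta //; last by rewrite mem_cat mem_head orbT.
  rewrite size_cat /= size_rcons !addnS sAB.
  by have := c_range kc => k2; have -> : (k - 2).+2 = k by lia.
have boi : b' ord0 i = 0 by rewrite /b' pi_0 pi_i; ring.
have biJ j : j != ord0 -> j != i -> b' i j = 0.
  by move=> j0 ji; rewrite /b' pi_i pi_j //; ring.
have bit : b' i ord_max = 0 by rewrite biJ // eq_sym.
have {}biJ : {in other_nodes, forall j, b' i j = 0}.
  by move=> j; rewrite mem_other_nodes internalE => /andP[/andP[j0 _] ji]; apply: biJ.
have flat : flat_cost ord0 ord_max other_nodes b'.
  have [[k [k' [kc k'c k_range k'k]]]|[c3 cn]] :=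
    cardinality_cases n_ge4 m_ge2 c_increasing c_range c_neq23 c_neq2n.
    have := c_range k'c => k'_range.
    (* From [4 <= k < n] follows [2 <= k - 2 < n - 2]. Both cardinalities are at least 2, so they
       remain distinct after subtracting 2. *)
    apply: (flat_cost_spare other_nodes_uniq boi bit biJ (through k kc) _ (through k' k'c)).
    - by rewrite size_other_nodes; lia.
    - by rewrite size_other_nodes; lia.
    - by lia.
  apply: (flat_cost_hamiltonian other_nodes_uniq boi bit biJ).
  - by rewrite size_other_nodes; lia.
  - exact: through c3.
  - by rewrite size_other_nodes; apply: through.
have [g gP] := walk_cost_flat flat.
exists (g + b ord0 i + b i ord_max) => p pP ip.
suff : walk_cost b' ord0 p = g by rewrite b'E // => <-; ring.
case/(simple_0n_pathP _ n_gt0): pP ip => s [-> s0 us sin].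
rewrite mem_rcons inE negb_or => /andP[_ is_]; apply: gP => // x xs.
by rewrite mem_other_nodes (allP sin) //; apply: contraNneq is_ => <-.
Qed.

End AvoidingPaths.

Theorem theorem9 (R : realType) (n : nat) (c : seq nat) (i : node n)
  (n_ge4 : (4 <= n)%N)
  (m_ge2 : (2 <= size c)%N)
  (c_increasing : sorted ltn c)
  (c_range : forall k : nat, k \in c -> (2 <= k <= n)%N)
  (c_neq23 : c <> [:: 2%N; 3%N])
  (i_internal : internal i)
  (c_neq2n : c <> [:: 2%N; n]) :
  induces_facet (path_polytope R n c) (arc_sum R (delta_out i)) 1%R.
Proof.
have [p0 [p0P p0c ip0]] := exists_avoiding_path n_ge4 m_ge2 c_increasing c_range i_internal.
pose X := map (incidence_vector R (n:=n)) (paths_of_length_in n c).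
have XP x : x \in X -> exists p, [/\ simple_0n_path p, size p \in c & x = incidence_vector R p].
  by move=> /mapP[p + ->]; rewrite mem_paths_of_length_in => /andP[pP pc]; exists p.
have inX p : simple_0n_path p -> size p \in c -> incidence_vector R p \in X.
  by move=> pP pc; apply: map_f; rewrite mem_paths_of_length_in pP.
pose f : {linear arc_vector R n -> R^o} := arc_sum R (delta_out i).
have fE p : simple_0n_path p -> f (incidence_vector R p) = (i \in p)%:R.
  exact: arc_sum_incidence.
apply: (@induces_facet_hull _ _ _ X f 1 (incidence_vector R p0)).
- by move=> x; split=> [[p [pP pc ->]]|/XP//]; apply: inX.
- by move=> _ /XP[p [pP _ ->]]; rewrite fE // lern1 leq_b1.
- exact: inX.
- by rewrite fE // (negPf ip0) ltr01.
move=> _ /XP[p [pP pc ->]]; rewrite fE // ltrn1 ltnS leqn0 eqb0 => ip.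
(* If the difference were outside the span, some [phi] would vanish on the lifted face but not on
   the difference. The arc costs of [phi] equal [- d] on admissible paths through [i], hence are
   constant on paths avoiding [i], and [phi] vanishes on the difference after all. *)
apply: contraT => /separating_functional[phi [phi0 /eqP[]]].
have [b [d phiE]] := linear_arc_vectorE phi.
have [|g gP] := @walk_cost_avoiding R n c i n_ge4 m_ge2 c_increasing c_range
  c_neq23 c_neq2n i_internal b (- d).
  move=> q qP qc iq; apply/eqP; rewrite -addr_eq0 -phiE //; apply/eqP/phi0.
  apply: memv_span; apply: map_f; rewrite mem_filter inX // andbT.
  by rewrite fE // iq.
by rewrite linearB /= !phiE // !gP // subrr.
Qed.
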